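(* Let $L\subset\mathbb{R}^n$ be an $n$-dimensional lattice, let $B=[b_1|\dots|b_n]^t$ be a basis of $L$, and write $B=D\cdot V$ where $D=\mathrm{diag}(\|b_1\|,\dots,\|b_n\|)$. Then $$S(B)=\|V^{-1}\|^2,$$ where on the right-hand side $\|\cdot\|$ is the Frobenius norm, $\|X\|=\sqrt{\sum_{i,j}|x_{ij}|^2}$, and $S(B)$ is the Seysen measure of $B$.
   Context: An $n$-dimensional lattice $L\subset\mathbb{R}^n$ is a set $L=\{\sum_{i=1}^n a_i b_i : a_i\in\mathbb{Z}\}$ with $b_1,\dots,b_n\in\mathbb{R}^n$ linearly independent over $\mathbb{R}$. A basis of $L$ is identified with the matrix $B=[b_1|\dots|b_n]^t$ whose rows $b_i$ are linearly independent and generate $L$ over $\mathbb{Z}$. The dual basis is $B^*=(B^{-1})^t=[b_1^*|\dots|b_n^*]^t$, so that $\langle b_i,b_j^*\rangle=\delta_{i,j}$. The Seysen measure of $B$ is $S(B)=\sum_{i=1}^n\|b_i\|^2\,\|b_i^*\|^2$, where $\|\cdot\|$ is the Euclidean norm on vectors. *)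

(* Defs.v *)
From HB Require Import structures.
From mathcomp Require Import all_boot all_order all_algebra.
From mathcomp Require Import boolp classical_sets reals.

Set Implicit Arguments.
Unset Strict Implicit.
Unset Printing Implicit Defensive.

Import Order.TTheory GRing.Theory Num.Theory.

Local Open Scope ring_scope.
Local Open Scope classical_set_scope.

(* Vectors of R^n are row vectors, and a family b_1, ..., b_n is the matrix
   whose i-th row is b_i; [row_free B] is linear independence over R. *)
Definition lattice_basis (R : realType) (n : nat) (L : set 'rV[R]_n)
    (B : 'M[R]_n) : Prop :=
  row_free B /\
  L = [set v | exists a : 'I_n -> int, v = \sum_(i < n) (a i)%:~R *: row i B].

Definition is_lattice (R : realType) (n : nat) (L : set 'rV[R]_n) : Prop :=
  exists B : 'M[R]_n, lattice_basis L B.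

Definition dual_basis (R : realType) (n : nat) (B : 'M[R]_n) : 'M[R]_n :=
  (invmx B)^T.

Definition enorm (R : realType) (n : nat) (v : 'rV[R]_n) : R :=
  Num.sqrt (\sum_(j < n) v 0 j ^+ 2).

Definition frobenius (R : realType) (m n : nat) (X : 'M[R]_(m, n)) : R :=
  Num.sqrt (\sum_(i < m) \sum_(j < n) `|X i j| ^+ 2).

Definition seysen (R : realType) (n : nat) (B : 'M[R]_n) : R :=
  \sum_(i < n) enorm (row i B) ^+ 2 * enorm (row i (dual_basis B)) ^+ 2.

Definition norm_diag (R : realType) (n : nat) (B : 'M[R]_n) : 'M[R]_n :=
  diag_mx (\row_(i < n) enorm (row i B)).

(* Main.v *)
Require Import Defs.
From HB Require Import structures.
From mathcomp Require Import all_boot all_order all_algebra.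
From mathcomp Require Import boolp classical_sets reals.

Set Implicit Arguments.
Unset Strict Implicit.
Unset Printing Implicit Defensive.

Import Order.TTheory GRing.Theory Num.Theory.

Local Open Scope ring_scope.
Local Open Scope classical_set_scope.

(** From $B=DV$ one gets $V^{-1}=B^{-1}D$. Right multiplication by $D$ scales column $j$ of
    $B^{-1}$, which is the dual vector $b_j^*$, by $\|b_j\|$. Summing the squared entries of
    $V^{-1}$ column by column therefore gives $\sum_j\|b_j\|^2\|b_j^*\|^2=S(B)$. *)

Lemma sqr_enorm (R : realType) (n : nat) (v : 'rV[R]_n) :
  enorm v ^+ 2 = \sum_(j < n) v 0 j ^+ 2.
Proof. by rewrite sqr_sqrtr // sumr_ge0 // => j _; exact: sqr_ge0. Qed.

Lemma sqr_frobenius (R : realType) (m n : nat) (X : 'M[R]_(m, n)) :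
  frobenius X ^+ 2 = \sum_(i < m) \sum_(j < n) X i j ^+ 2.
Proof.
rewrite sqr_sqrtr; last by do 2!(apply: sumr_ge0 => ? _); exact: sqr_ge0.
by do 2!(apply: eq_bigr => ? _); rewrite real_normK ?num_real.
Qed.

Theorem proposition3p1 (R : realType) (n : nat) (L : set 'rV[R]_n)
    (hL : is_lattice L) (B : 'M[R]_n) (hB : lattice_basis L B)
    (V : 'M[R]_n) (hV : B = norm_diag B *m V) :
  seysen B = frobenius (invmx V) ^+ 2.
Proof.
have uB : B \in unitmx by rewrite -row_free_unit; case: hB.
(* A left inverse of a square matrix is its inverse, so this identity yields both the invertibility
   of [V] and the formula for [invmx V], without inverting $D$. *)
have VE : (invmx B *m norm_diag B) *m V = 1%:M by rewrite -mulmxA -hV mulVmx.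
have [_ uV] := mulmx1_unit VE.
have -> : invmx V = invmx B *m norm_diag B.
  by rewrite -[RHS](mulmxK uV) VE mul1mx.
(* The outer index becomes the column [j] of [invmx V], matching the [j]-th term of [seysen B]. *)
rewrite sqr_frobenius exchange_big; apply: eq_bigr => j _.
rewrite mulrC (sqr_enorm (row j (dual_basis B))) mulr_suml.
by apply: eq_bigr => i _; rewrite mul_mx_diag !mxE exprMn.
Qed.
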